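(* For all $a,b\in\mathbb{N}$, $T_7([a,b,G])$ is a sum of monomials $[c,d,G]$ with $c+d<a+b$. Moreover, if $a>0$, then $T_7([a,b,G])=[a-1,b,G]+(\text{a sum of monomials earlier than }[a-1,b,G])$.
   Context: For an odd prime $p$, $T_p:\mathbb{Z}/2[[x]]\to\mathbb{Z}/2[[x]]$ is the map $\sum c_nx^n\mapsto\sum c_{pn}x^n+\sum c_nx^{pn}$. Let $D=\sum_{n>0,\ \gcd(n,6)=1}x^{n^2}\in\mathbb{Z}/2[[x]]$. Let $g:\mathbb{N}\to\mathbb{N}$ be the function with $g(0)=0$, $g(2n)=4g(n)$, $g(2n+1)=g(2n)+1$. For $a,b\in\mathbb{N}$ put $[a,b,G]=D^{5+6g(a)+12g(b)}$; these are exactly the $D^n$ with $n>0$, $n\equiv5\pmod 6$, each arising from a unique $(a,b)$. These monomials are totally ordered by: $[c,d,G]$ is earlier than $[a,b,G]$ if $c+d<a+b$, or if $c+d=a+b$ and $d<b$. *)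

(* Defs.v *)
From HB Require Import structures.
From mathcomp Require Import all_boot all_order all_algebra.
From mathcomp Require Import boolp.

Set Implicit Arguments.
Unset Strict Implicit.
Unset Printing Implicit Defensive.

Import GRing.Theory.
Local Open Scope ring_scope.

(* Formal power series R[[x]]: the series \sum_n c_n x^n is represented by its
   coefficient function n |-> c_n, wrapped in a record so that the ring
   structure is the Cauchy product and not the pointwise one. *)
Record series (R : Type) := Series { coefs : nat -> R }.
Coercion coefs : series >-> Funclass.

HB.instance Definition _ (R : Type) := gen_eqMixin (series R).
HB.instance Definition _ (R : Type) := gen_choiceMixin (series R).

Lemma seriesP (R : Type) (f h : series R) : f =1 h -> f = h.
Proof. by case: f h => [f] [h] /= /funext ->. Qed.

Section SeriesRing.
Variable R : comNzRingType.
Implicit Types f h k : series R.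

Definition series0 : series R := Series (fun=> 0).
Definition seriesN f : series R := Series (fun n => - f n).
Definition seriesD f h : series R := Series (fun n => f n + h n).
Definition series1 : series R := Series (fun n => (n == 0%N)%:R).
Definition seriesM f h : series R :=
  Series (fun n => \sum_(i < n.+1) f i * h (n - i)%N).

Fact seriesDA : associative seriesD.
Proof. by move=> f h k; apply: seriesP => n /=; rewrite addrA. Qed.
Fact seriesDC : commutative seriesD.
Proof. by move=> f h; apply: seriesP => n /=; rewrite addrC. Qed.
Fact series0D : left_id series0 seriesD.
Proof. by move=> f; apply: seriesP => n /=; rewrite add0r. Qed.
Fact seriesND : left_inverse series0 seriesN seriesD.
Proof. by move=> f; apply: seriesP => n /=; rewrite addNr. Qed.

HB.instance Definition _ :=
  GRing.isZmodule.Build (series R) seriesDA seriesDC series0D seriesND.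

Let trunc f n : {poly R} := \poly_(i < n) f i.

Let seriesM_trunc f h n m : (n < m)%N ->
  seriesM f h n = (trunc f m * trunc h m)`_n.
Proof.
move=> nm; rewrite coefM /=; apply: eq_bigr => i _.
have im : (i < m)%N by apply: leq_trans nm; apply: ltn_ord.
by rewrite !coef_poly im (leq_ltn_trans (leq_subr _ _) nm).
Qed.

Fact seriesMC : commutative seriesM.
Proof.
by move=> f h; apply: seriesP => n; rewrite !(seriesM_trunc _ _ (ltnSn n)) mulrC.
Qed.

Fact seriesMA : associative seriesM.
Proof.
move=> f h k; apply: seriesP => n.
transitivity ((trunc f n.+1 * (trunc h n.+1 * trunc k n.+1))`_n).
  rewrite coefM; apply: eq_bigr => i _.
  have le_in : (i <= n)%N by rewrite -ltnS.
  rewrite coef_poly ltn_ord (seriesM_trunc h k (m := n.+1)) //.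
  by rewrite ltnS leq_subr.
rewrite mulrA coefM; apply: eq_bigr => i _.
by rewrite coef_poly ltnS leq_subr (seriesM_trunc f h (m := n.+1)) ?ltn_ord.
Qed.

Fact series1M : left_id series1 seriesM.
Proof.
move=> f; apply: seriesP => n /=.
by rewrite big_ord_recl /= mul1r subn0 big1 ?addr0 // => i _; rewrite mul0r.
Qed.

Fact seriesMDl : left_distributive seriesM +%R.
Proof.
move=> f h k; apply: seriesP => n /=; rewrite -big_split /=.
by apply: eq_bigr => i _; rewrite mulrDl.
Qed.

Fact series1_neq0 : series1 != 0.
Proof.
by apply/eqP => /(congr1 (fun f : series R => f 0%N)) /= /eqP; rewrite oner_eq0.
Qed.

HB.instance Definition _ :=
  GRing.Zmodule_isComNzRing.Build (series R)
    seriesMA seriesMC series1M seriesMDl series1_neq0.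

End SeriesRing.

Definition hecke (p : nat) (f : series 'F_2) : series 'F_2 :=
  Series (fun n => f (p * n)%N + (if (p %| n)%N then f (n %/ p)%N else 0)).

(* m ^ 2 = n forces m <= n, so ranging over m < n.+1 loses no term. *)
Definition D : series 'F_2 :=
  Series (fun n =>
    \sum_(m < n.+1 | [&& (0 < m)%N, coprime m 6 & (m ^ 2 == n)%N]) 1).

(* The first argument of g_rec is fuel; n halvings suffice to exhaust n. *)
Fixpoint g_rec (k n : nat) : nat :=
  if k is k'.+1 then (4 * g_rec k' n./2 + odd n)%N else 0%N.
Definition g (n : nat) : nat := g_rec n n.

Fact g_recE k n : (n <= k)%N -> g_rec k n = g n.
Proof.
rewrite /g; elim/ltn_ind: n k => -[|n] IH k le_nk.
  by elim: k {le_nk IH} => //= k ->.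
case: k le_nk => // k le_nk /=.
have lt_h : (uphalf n < n.+1)%N by rewrite ltnS leq_uphalf_double -addnn leq_addr.
have le_hn : (uphalf n <= n)%N by rewrite -ltnS.
by rewrite !IH // (leq_trans le_hn).
Qed.

Fact g0 : g 0 = 0%N. Proof. by []. Qed.

Fact gE n : g n = (4 * g n./2 + odd n)%N.
Proof.
rewrite -(@g_recE n.+1 n) //= g_recE //.
by rewrite leq_half_double -addnn ltnW // ltnS leq_addr.
Qed.

Fact g_even n : g (2 * n) = (4 * g n)%N.
Proof. by rewrite gE mul2n doubleK odd_double addn0. Qed.

Fact g_odd n : g (2 * n + 1) = (g (2 * n) + 1)%N.
Proof.
by rewrite gE g_even addn1 mul2n /= uphalf_double odd_double.
Qed.

Definition monG (a b : nat) : series 'F_2 := D ^+ (5 + 6 * g a + 12 * g b)%N.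

(* (a, b) |-> monG a b is injective, so the total order on the monomials is
   expressed on their index pairs: earlier (c, d) (a, b) says that monG c d
   is earlier than monG a b. *)
Definition earlier (u v : nat * nat) : bool :=
  (u.1 + u.2 < v.1 + v.2)%N ||
  ((u.1 + u.2 == v.1 + v.2)%N && (u.2 < v.2)%N).

(* Main.v *)
Require Import Defs.
From mathcomp Require Import all_boot all_order all_algebra.
From mathcomp Require Import zify ring.

(** Write [X = D], [Y = D(x^7)], [T = T_7]. Everything rests on the modular
    equation [X^8 + Y^8 + X Y + (X Y)^4 = 0]. Its coefficient at [x^N] compares
    the numbers of solutions of [m^2 + 7 n^2 = N] and [m^2 + 7 n^2 = N / 4] modulo 2;
    multiplying [(m + n sqrt(-7)) / 2] (or its conjugate) by powers of [pi / pi'],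
    where [2 = pi pi'] in [Z[(1 + sqrt(-7)) / 2]], gives involutions and a bijection
    which leave only [N = 8 k^2] and [N = 56 k^2].

    Since [T f] is the sum of the decimation of [f] and of [f(x^7)], any relation
    symmetric in [X], [Y] yields a linear recurrence for [T(X^n)]. The relations used
    are the [2^k]-th powers of the modular equation and of its consequence
    [X^24 + Y^24 + (X Y)^3 + (X Y)^6 = 0], which gives, for [q = 2^k] and
    [t = X^6],
      [T(X^5 t^(m+8q)) = t^(8q) T(X^5 t^m) + t^q T(X^5 t^(m+q)) + t^(2q) T(X^5 t^(m+2q))].

    The monomial [a,b,G] is [X^5 t^m], where [a] and [b] are read off the binary
    digits of [m] of even and odd rank. The pair [(a + b, b)], ordered
    lexicographically, is subadditive in [m], strictly as soon as a carry occurs.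
    Taking [8q] to be the leading binary digit of [m], exactly one of the three terms
    of the recurrence contributes the leading monomial [a-1,b,G]. *)

Set Implicit Arguments.
Unset Strict Implicit.
Unset Printing Implicit Defensive.
Import GRing.Theory.

(** * Binary digits of even and odd rank *)

(* [ebits n] and [obits n] are inverse to [(a, b) |-> g a + 2 * g b]; the first
   argument of ebits_rec is fuel. *)
Fixpoint ebits_rec (k n : nat) : nat :=
  if k is k'.+1 then odd n + 2 * ebits_rec k' (n %/ 4) else 0.

Definition ebits (n : nat) : nat := ebits_rec n n.
Definition obits (n : nat) : nat := ebits (n %/ 2).

Lemma ebits_recE k n : n <= k -> ebits_rec k n = ebits n.
Proof.
rewrite /ebits; elim/ltn_ind: n k => -[|n] IH k le_nk.
  by elim: k {le_nk IH} => //= k ->.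
by case: k le_nk => // k le_nk /=; rewrite !IH //; lia.
Qed.

Lemma ebitsE n : ebits n = odd n + 2 * ebits (n %/ 4).
Proof. by rewrite -(@ebits_recE n.+1 n) //= ebits_recE //; lia. Qed.

Lemma obitsE n : obits n = odd (n %/ 2) + 2 * obits (n %/ 4).
Proof. by rewrite {1}/obits ebitsE /obits -!divnMA. Qed.

Lemma ebits_add4 x r : r < 4 -> ebits (4 * x + r) = odd r + 2 * ebits x.
Proof.
by move=> r4; rewrite ebitsE; congr (_ + 2 * ebits _); [congr nat_of_bool|]; lia.
Qed.

Lemma obits_add4 x r : r < 4 -> obits (4 * x + r) = r %/ 2 + 2 * obits x.
Proof.
by move=> r4; rewrite obitsE; congr (_ + 2 * obits _); lia.
Qed.

Lemma bits_code n : g (ebits n) + 2 * g (obits n) = n.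
Proof.
elim/ltn_ind: n => -[|n] IH //.
have e := IH (n.+1 %/ 4) ltac:(lia); rewrite ebitsE obitsE.
rewrite (gE (_ + 2 * ebits _)) (gE (_ + 2 * obits _)).
have h b x : ((nat_of_bool b + 2 * x)./2 = x) * (odd (b + 2 * x) = b).
  by case: b; split; lia.
by rewrite !h; lia.
Qed.

Definition code (a b : nat) : nat := g a + 2 * g b.

Lemma bits_of_code a b : ebits (code a b) = a /\ obits (code a b) = b.
Proof.
rewrite /code; have [n] := ubnP (a + b); elim: n a b => // n IH a b ab.
have [ab0|ab0] : a + b = 0 \/ 0 < a + b by lia.
  have -> : a = 0 by lia. by have -> : b = 0 by lia.
have [h1 h2] := IH a./2 b./2 ltac:(lia).
have -> : g a + 2 * g b = 4 * (g a./2 + 2 * g b./2) + (odd a + 2 * odd b).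
  by rewrite (gE a) (gE b); lia.
have lt4 : odd a + 2 * odd b < 4 by lia.
by rewrite ebits_add4 // obits_add4 // h1 h2; split; lia.
Qed.

Definition lexle (u v : nat * nat) : bool := ~~ earlier v u.

(** A carry out of even rank trades [2 * 2^k] in [ebits] for [2^k] in [obits], which lowers the sum;
    a carry out of odd rank trades [2 * 2^k] in [obits] for [2^(k+1)] in [ebits], which keeps the
    sum and lowers [obits]. The incoming carry [c] lets the induction on base-4 digits close. *)
Lemma bits_add_carry x y c : c <= 1 ->
  lexle (ebits (x + y + c), obits (x + y + c)) (ebits x + ebits y + c, obits x + obits y).
Proof.
have [n] := ubnP (x + y); elim: n x y c => // n IH x y c xy c1.
have [xy0|xy0] : x + y = 0 \/ 0 < x + y by lia.
  have -> : x = 0 by lia. have -> : y = 0 by lia.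
  by case: c c1 => [|[|]].
have {IH} IH c' : c' <= 1 -> lexle (ebits (x %/ 4 + y %/ 4 + c'), obits (x %/ 4 + y %/ 4 + c'))
   (ebits (x %/ 4) + ebits (y %/ 4) + c', obits (x %/ 4) + obits (y %/ 4)).
  by apply: IH; lia.
have [ex ey] : x = 4 * (x %/ 4) + x %% 4 /\ y = 4 * (y %/ 4) + y %% 4 by lia.
have := ltn_pmod x (isT : 0 < 4); have := ltn_pmod y (isT : 0 < 4).
move: (x %/ 4) (y %/ 4) (x %% 4) (y %% 4) ex ey IH => x' y' r s -> -> IH s4 r4.
have -> : 4 * x' + r + (4 * y' + s) + c
  = 4 * (x' + y' + (r + s + c) %/ 4) + (r + s + c) %% 4 by lia.
have := IH ((r + s + c) %/ 4) ltac:(lia).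
rewrite !ebits_add4 // ?obits_add4 // ?ltn_pmod //.
rewrite /lexle /earlier /=.
move: (ebits (x' + y' + _)) (obits (x' + y' + _)) (ebits x') (ebits y') (obits x') (obits y').
clear -s4 r4 c1; move=> e o ex ey ox oy.
case: r r4 => [|[|[|[|//]]]] _; case: s s4 => [|[|[|[|//]]]] _;
  case: c c1 => [|[|//]] _; rewrite ?addn0 ?add0n /=; lia.
Qed.

Lemma bits_add x y :
  lexle (ebits (x + y), obits (x + y)) (ebits x + ebits y, obits x + obits y).
Proof. by have := @bits_add_carry x y 0 isT; rewrite !addn0. Qed.

Lemma ebits_div z k : ebits (z %/ 4 ^ k) = ebits z %/ 2 ^ k.
Proof.
elim: k => [|k IH]; first by rewrite !divn1.
rewrite !expnSr !divnMA -IH (ebitsE (z %/ 4 ^ k)); lia.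
Qed.

Lemma obits_div z k : obits (z %/ 4 ^ k) = obits z %/ 2 ^ k.
Proof. by rewrite /obits -divnMA mulnC divnMA ebits_div. Qed.

Lemma odd_ebits_div z k : odd (ebits z %/ 2 ^ k) = odd (z %/ 4 ^ k).
Proof. by rewrite -ebits_div ebitsE; lia. Qed.

Lemma odd_obits_div z k : odd (obits z %/ 2 ^ k) = odd (z %/ (2 * 4 ^ k)).
Proof. by rewrite -obits_div obitsE -divnMA mulnC; lia. Qed.

Lemma bits_addX4 z k : ~~ odd (ebits z %/ 2 ^ k) ->
  ebits (z + 4 ^ k) = ebits z + 2 ^ k /\ obits (z + 4 ^ k) = obits z.
Proof.
elim: k z => [|k IH] z h.
  rewrite divn1 in h; have {}h : ~~ odd z by move: h; rewrite ebitsE; lia.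
  rewrite !expn0 ebitsE (ebitsE z) /obits.
  have [-> ->] : (z + 1) %/ 4 = z %/ 4 /\ (z + 1) %/ 2 = z %/ 2 by lia.
  by split; lia.
have [] := IH (z %/ 4).
  by move: h; rewrite !odd_ebits_div expnS divnMA.
have -> : z + 4 ^ k.+1 = 4 * (z %/ 4 + 4 ^ k) + z %% 4 by rewrite expnS; lia.
rewrite ebits_add4 ?obits_add4 ?ltn_pmod // => -> ->.
by rewrite (ebitsE z) (obitsE z) expnS; split; lia.
Qed.

Lemma bits_add2X4 z k : ~~ odd (obits z %/ 2 ^ k) ->
  ebits (z + 2 * 4 ^ k) = ebits z /\ obits (z + 2 * 4 ^ k) = obits z + 2 ^ k.
Proof.
elim: k z => [|k IH] z h.
  rewrite divn1 in h; have {}h : ~~ odd (z %/ 2) by move: h; rewrite obitsE; lia.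
  rewrite !expn0 muln1 ebitsE (ebitsE z) obitsE (obitsE z).
  have -> : (z + 2) %/ 4 = z %/ 4 by lia.
  by split; lia.
have [] := IH (z %/ 4).
  by move: h; rewrite !odd_obits_div -divnMA expnS mulnCA.
have -> : z + 2 * 4 ^ k.+1 = 4 * (z %/ 4 + 2 * 4 ^ k) + z %% 4 by rewrite expnS; lia.
rewrite ebits_add4 ?obits_add4 ?ltn_pmod // => -> ->.
by rewrite (ebitsE z) (obitsE z) expnS; split; lia.
Qed.

Lemma bits_X4 k : ebits (4 ^ k) = 2 ^ k /\ obits (4 ^ k) = 0.
Proof. by have := @bits_addX4 0 k; rewrite div0n; apply. Qed.

Lemma bits_2X4 k : ebits (2 * 4 ^ k) = 0 /\ obits (2 * 4 ^ k) = 2 ^ k.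
Proof. by have := @bits_add2X4 0 k; rewrite div0n; apply. Qed.

Lemma bits_addX4_carry z k : odd (ebits z %/ 2 ^ k) ->
  earlier (ebits (z + 4 ^ k), obits (z + 4 ^ k)) (ebits z + 2 ^ k, obits z).
Proof.
rewrite odd_ebits_div => h.
have le_z : 4 ^ k <= z by rewrite -divn_gt0 ?expn_gt0 //; case: (z %/ _) h.
have [z' ez] : exists z', z = z' + 4 ^ k by exists (z - 4 ^ k); rewrite subnK.
have h' : ~~ odd (ebits z' %/ 2 ^ k).
  by move: h; rewrite ez odd_ebits_div divnDr // divnn expn_gt0 /= addn1.
rewrite ez; have [-> ->] := bits_addX4 h'.
(* Twice [4^k] is one digit of odd rank, worth [2^k] in place of [2 * 2^k]: the sum drops. *)
have := bits_add z' (2 * 4 ^ k); have [-> ->] := bits_2X4 k.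
rewrite mul2n -addnn addnA /lexle /earlier /=; have := expn_gt0 2 k; lia.
Qed.

Lemma bits_add2X4_carry z k : odd (obits z %/ 2 ^ k) ->
  earlier (ebits (z + 2 * 4 ^ k), obits (z + 2 * 4 ^ k)) (ebits z, obits z + 2 ^ k).
Proof.
rewrite odd_obits_div => h.
have p0 : 0 < 2 * 4 ^ k by rewrite muln_gt0 expn_gt0.
have le_z : 2 * 4 ^ k <= z by rewrite -divn_gt0 //; case: (z %/ _) h.
have [z' ez] : exists z', z = z' + 2 * 4 ^ k by exists (z - 2 * 4 ^ k); rewrite subnK.
have h' : ~~ odd (obits z' %/ 2 ^ k).
  by move: h; rewrite ez odd_obits_div divnDr // divnn p0 /= addn1.
rewrite ez; have [-> ->] := bits_add2X4 h'.
(* Twice [2 * 4^k] is one digit of even rank, worth [2^(k+1)]: the same total, but moved out of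
   [obits]. *)
have := bits_add z' (4 ^ k.+1); have [-> ->] := bits_X4 k.+1.
have -> : z' + 2 * 4 ^ k + 2 * 4 ^ k = z' + 4 ^ k.+1 by rewrite expnS; lia.
rewrite /lexle /earlier /= expnS; have := expn_gt0 2 k; lia.
Qed.

Local Open Scope ring_scope.

(** * Sums over F_2 and the Frobenius *)

Lemma addF2 (x : 'F_2) : x + x = 0.
Proof. by case: x => -[|[|[]]] // i; apply/val_inj. Qed.

Lemma addss (f : series 'F_2) : f + f = 0.
Proof. by apply: seriesP => n /=; apply: addF2. Qed.

(** Each pair of distinct elements [x], [f x] contributes [2 F x = 0]. Comparing [pickle] codes
    selects one element per pair, and [f] exchanges the selected elements with the others. *)
Lemma big_involution (T : countType) (s : seq T) (f : T -> T) (F : T -> 'F_2) :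
  uniq s -> {in s, forall x, f x \in s} -> {in s, involutive f} ->
  {in s, forall x, F (f x) = F x} ->
  \sum_(x <- s) F x = \sum_(x <- s | f x == x) F x.
Proof.
move=> us fs ff Ff.
rewrite (bigID (fun x => f x == x)) /=.
rewrite [X in _ + X](bigID (fun x => (pickle x < pickle (f x))%N)) /=.
have -> : \sum_(x <- s | (f x != x) && ~~ (pickle x < pickle (f x))%N) F x
        = \sum_(x <- s | (f x != x) && (pickle x < pickle (f x))%N) F x.
  rewrite -big_filter -[RHS]big_filter.
  set s1 := filter _ _; set s2 := filter _ _.
  have -> : \sum_(x <- s2) F x = \sum_(x <- map f s2) F x.
    rewrite big_map big_seq [RHS]big_seq; apply: eq_bigr => x.
    by rewrite mem_filter => /andP[_ xs]; rewrite Ff.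
  apply: perm_big; apply: uniq_perm; first exact: filter_uniq.
    rewrite map_inj_in_uniq ?filter_uniq // => x y.
    rewrite !mem_filter => /andP[_ xs] /andP[_ ys] e.
    by rewrite -(ff x) // e ff.
  move=> x; apply/idP/mapP.
    rewrite mem_filter -leqNgt => /andP[/andP[ne le] xs].
    exists (f x); last by rewrite ff.
    rewrite mem_filter ff // fs // andbT eq_sym ne /= ltn_neqAle le andbT.
    by apply/eqP => /(pcan_inj (@pickleK _)) e; rewrite e eqxx in ne.
  case=> y; rewrite mem_filter => /andP[/andP[ne le] ys] ->.
  by rewrite mem_filter ff // fs // andbT eq_sym ne /= -leqNgt ltnW.
by rewrite addF2 addr0.
Qed.

Lemma series_sqrE (f : series 'F_2) n :
  (f ^+ 2) n = if (2 %| n)%N then f (n %/ 2)%N else 0.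
Proof.
rewrite expr2 /=.
rewrite -(big_mkord predT (fun i => f i * f (n - i)%N)) /=.
rewrite (@big_involution _ _ (fun i => n - i)%N) ?iota_uniq //; first last.
- move=> x; rewrite mem_index_iota /= => xn.
  by rewrite subKn 1?mulrC //; lia.
- by move=> x; rewrite mem_index_iota /= => xn; rewrite subKn //; lia.
- by move=> x; rewrite !mem_index_iota; lia.
case: ifP => dn.
  rewrite -big_filter.
  have -> : [seq i <- index_iota 0 n.+1 | (n - i)%N == i] = [:: (n %/ 2)%N].
    apply: perm_small_eq => //; apply: uniq_perm => //.
      by rewrite filter_uniq ?iota_uniq.
    by move=> x; rewrite mem_filter mem_index_iota inE; lia.
  rewrite big_seq1; have -> : (n - n %/ 2 = n %/ 2)%N by lia.
  by case: (f _) => -[|[|[]]] // i; apply/val_inj.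
rewrite big_seq_cond big1 // => i; rewrite mem_index_iota; lia.
Qed.

(** * Solutions of m^2 + 7 n^2 = N *)

Lemma coprime6E m : coprime m 6 = (m %% 6 == 1)%N || (m %% 6 == 5)%N.
Proof.
rewrite /coprime -gcdn_modl; have := ltn_pmod m (isT : 0 < 6)%N.
by move: (m %% 6)%N => -[|[|[|[|[|[|]]]]]].
Qed.

(** The square modulo 32 depends only on [m] modulo 16 and determines it up to sign, so congruences
    on [m^2 + 7 n^2] yield linear ones between [m] and [n]. *)
Lemma odd_sqr_mod32 m : odd m ->
  ((m %% 16 = 1 \/ m %% 16 = 15) /\ m ^ 2 %% 32 = 1 \/
   (m %% 16 = 3 \/ m %% 16 = 13) /\ m ^ 2 %% 32 = 9 \/
   (m %% 16 = 5 \/ m %% 16 = 11) /\ m ^ 2 %% 32 = 25 \/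
   (m %% 16 = 7 \/ m %% 16 = 9) /\ m ^ 2 %% 32 = 17)%N.
Proof.
move=> om.
have -> : (m ^ 2 %% 32 = (m %% 16) ^ 2 %% 32)%N.
  rewrite {1}(divn_eq m 16).
  have -> : ((m %/ 16 * 16 + m %% 16) ^ 2
    = (8 * (m %/ 16) ^ 2 + (m %/ 16) * (m %% 16)) * 32 + (m %% 16) ^ 2)%N by ring.
  by rewrite modnMDl.
have : (m %% 16 \in [:: 1; 3; 5; 7; 9; 11; 13; 15])%N by rewrite !inE; lia.
by rewrite !inE => /or4P[|||/or4P[||| /orP[]]] /eqP ->; tauto.
Qed.

Definition absdiff (m n : nat) : nat := (m - n + (n - m))%N.

(* Up to sign, multiplication of the conjugate m - n sqrt(-7) by pi / pi', with
   pi = (1 + sqrt(-7)) / 2, when m = n mod 8; otherwise n is replaced by - n, which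
   exchanges pi and pi'. *)
Definition refl8 (u : nat * nat) : nat * nat :=
  if (u.1 %% 8 == u.2 %% 8)%N
  then (absdiff (7 * u.2) (3 * u.1) %/ 4, (u.1 + 3 * u.2) %/ 4)%N
  else ((3 * u.1 + 7 * u.2) %/ 4, absdiff u.1 (3 * u.2) %/ 4)%N.

Definition sol (N : nat) (u : nat * nat) : bool :=
  [&& coprime u.1 6, coprime u.2 6 & (u.1 ^ 2 + 7 * u.2 ^ 2 == N)%N].

(** Since [pi / pi'] has norm 1, the quadratic form is preserved; the congruence [key] makes the
    quotients by 4 exact. The fixed lines [m = n] and [m = 7 n] correspond to [N = 8 n^2] and
    [N = 56 n^2]. *)
Lemma refl8P N u : (N %% 16 = 8)%N -> sol N u ->
  [/\ sol N (refl8 u), refl8 (refl8 u) = u &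
      (refl8 u == u) = (u.1 == u.2) || (u.1 == 7 * u.2)%N].
Proof.
case: u => m n N8; rewrite /sol /= !coprime6E => /and3P[hm hn /eqP hN].
have om : odd m by lia. have on : odd n by lia.
have := odd_sqr_mod32 om; have := odd_sqr_mod32 on => sn sm.
(* As [n] is odd, [7 n^2 = 8 - n^2] modulo 16, so [m^2 = n^2] modulo 16. *)
have key : (m %% 8 = n %% 8 \/ (m + n) %% 8 = 0)%N.
  by move: hN sn sm N8; move: (m ^ 2)%N (n ^ 2)%N; clear; lia.
clear sn sm.
(* Absolute values become subtraction-free linear equations, one disjunct per sign, suited to [nia]
   and [lia]. *)
have [m' [n' [-> e]]] : exists m' n', refl8 (m, n) = (m', n') /\
  ((m %% 8 = n %% 8 /\ (4 * m' + 3 * m = 7 * n \/ 4 * m' + 7 * n = 3 * m) /\ 4 * n' = m + 3 * n)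
  \/ ((m + n) %% 8 = 0 /\ 4 * m' = 3 * m + 7 * n /\ (4 * n' + 3 * n = m \/ 4 * n' + m = 3 * n)))%N.
  rewrite /refl8 /=; case: eqP => e; do 2!eexists; (split; first reflexivity).
    by left; rewrite /absdiff; lia.
  by right; rewrite /absdiff; lia.
have eN : (m' ^ 2 + 7 * n' ^ 2 = N)%N.
  by move: e; rewrite -hN; clear; nia.
clear hN.
split.
- rewrite /= eN eqxx andbT; clear eN; lia.
- clear -e om on; rewrite /refl8 /=.
  case: e => [[e1 [[e2|e2] e3]]|[e1 [e2 [e3|e3]]]]; case: eqP => e';
    try lia; by rewrite /absdiff; congr (_, _); lia.
- rewrite xpair_eqE; clear eN; lia.
Qed.

(* As refl8, with (pi / pi')^2: one of m + 3 n, m - 3 n is 8 k, up to sign. *)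
Definition refl16 (u : nat * nat) : nat * nat :=
  if ((u.1 + 3 * u.2) %% 8 == 0)%N
  then let k := ((u.1 + 3 * u.2) %/ 8)%N in (absdiff k (3 * u.2), absdiff u.2 (3 * k))%N
  else if (u.1 <= 3 * u.2)%N
  then let k := ((3 * u.2 - u.1) %/ 8)%N in (absdiff k (3 * u.2), absdiff u.2 (3 * k))%N
  else let k := ((u.1 - 3 * u.2) %/ 8)%N in (k + 3 * u.2, u.2 + 3 * k)%N.

(** A fixed point would force [k = 0] or [3 k = 2 n], hence 3 would divide [m] or [n], against
    coprimality to 6. *)
Lemma refl16P N u : (N %% 32 = 16)%N -> sol N u ->
  [/\ sol N (refl16 u), refl16 (refl16 u) = u & refl16 u != u].
Proof.
case: u => m n N16; rewrite /sol /= !coprime6E => /and3P[hm hn /eqP hN].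
have om : odd m by lia. have on : odd n by lia.
have := odd_sqr_mod32 om; have := odd_sqr_mod32 on => sn sm.
(* Modulo 32, [m^2 = 16 - 7 n^2 = 9 n^2], so [m] is [3 n] or [- 3 n] modulo 16; this is why [k] is
   even. *)
have [k key] : exists k, (~~ odd k /\
   (m + 3 * n = 8 * k \/ m + 8 * k = 3 * n \/ m = 3 * n + 8 * k))%N.
  have : ((m + 3 * n) %% 16 = 0 \/ (m + 13 * n) %% 16 = 0)%N.
    by move: hN sn sm N16; move: (m ^ 2)%N (n ^ 2)%N; clear; lia.
  clear hN sn sm; case=> h; first by exists ((m + 3 * n) %/ 8)%N; lia.
  by case: (leqP m (3 * n)) => h'; [exists ((3 * n - m) %/ 8)%N|exists ((m - 3 * n) %/ 8)%N]; lia.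
have [m' [n' [-> e]]] : exists m' n', refl16 (m, n) = (m', n') /\
  ((m + 3 * n = 8 * k \/ m + 8 * k = 3 * n) /\ (m' + k = 3 * n \/ m' + 3 * n = k) /\
      (n' + 3 * k = n \/ n' + n = 3 * k)
  \/ m = 3 * n + 8 * k /\ m' = k + 3 * n /\ n' = n + 3 * k)%N.
  do 2!eexists; split; first by apply: surjective_pairing.
  clear -key om on; rewrite /refl16 /absdiff /=.
  case: key => _ [e|[e|e]].
  - have -> : ((m + 3 * n) %% 8 == 0)%N by rewrite e modnMr.
    have -> : ((m + 3 * n) %/ 8 = k)%N by rewrite e mulKn.
    by rewrite /=; lia.
  - have -> : ((m + 3 * n) %% 8 == 0)%N = false by lia.
    have -> : (m <= 3 * n)%N by lia.
    have -> : ((3 * n - m) %/ 8 = k)%N by rewrite -e addKn mulKn.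
    by rewrite /=; lia.
  - have -> : ((m + 3 * n) %% 8 == 0)%N = false by lia.
    case: leqP => h; last first.
      have -> : ((m - 3 * n) %/ 8 = k)%N by rewrite e addKn mulKn.
      by rewrite /=; lia.
    have -> : ((3 * n - m) %/ 8 = k)%N by lia.
    by rewrite /=; lia.
have eN : (m' ^ 2 + 7 * n' ^ 2 = N)%N.
  by move: e; rewrite -hN; clear; nia.
clear hN.
split.
- rewrite /= eN eqxx andbT; clear -e key hm hn.
  have {key} [ek _] := key.
  by case: e => [[[e1|e1] [[e2|e2] [e3|e3]]]|[e1 [e2 e3]]]; apply/andP; split; lia.
- clear -e key om on; rewrite /refl16 /=.
  have {key} [ek _] := key.
  case: e => [[[e1|e1] [[e2|e2] [e3|e3]]]|[e1 [e2 e3]]];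
    (case: eqP => e'; try lia); try (case: leqP => e'' /=; try lia);
    by rewrite /absdiff; congr (_, _); lia.
- rewrite xpair_eqE; clear -e hm hn; apply/negP => /andP[/eqP e4 /eqP e5]; subst m' n'.
  by case: e => [[[e1|e1] [[e2|e2] [e3|e3]]]|[e1 [e2 e3]]]; lia.
Qed.

(* Division of m + n sqrt(-7) by pi^2, resp. pi'^2. *)
Definition sol_down (u : nat * nat) : nat * nat :=
  if ((u.1 + 3 * u.2) %% 8 == 0)%N
  then let k := ((u.1 + 3 * u.2) %/ 8)%N in (absdiff (2 * u.2) (3 * k), k)%N
  else if (u.1 <= 3 * u.2)%N
  then let k := ((3 * u.2 - u.1) %/ 8)%N in (absdiff (2 * u.2) (3 * k), k)%N
  else let k := ((u.1 - 3 * u.2) %/ 8)%N in (2 * u.2 + 3 * k, k)%N.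

Definition sol_up (v : nat * nat) : nat * nat :=
  if ((v.1 + 3 * v.2) %% 4 == 2)%N
  then let n := ((v.1 + 3 * v.2) %/ 2)%N in (absdiff (8 * v.2) (3 * n), n)%N
  else if (3 * v.2 <= v.1)%N
  then let n := ((v.1 - 3 * v.2) %/ 2)%N in (3 * n + 8 * v.2, n)%N
  else let n := ((3 * v.2 - v.1) %/ 2)%N in (absdiff (3 * n) (8 * v.2), n)%N.

(** Subtraction-free form of [u = v pi^2], up to conjugation and the signs of the coordinates. *)
Definition sol_link (u v : nat * nat) : Prop :=
  (u.1 + 3 * u.2 = 8 * v.2 /\ (v.1 + 3 * v.2 = 2 * u.2 \/ v.1 + 2 * u.2 = 3 * v.2) \/
   u.1 + 8 * v.2 = 3 * u.2 /\ (v.1 + 3 * v.2 = 2 * u.2 \/ v.1 + 2 * u.2 = 3 * v.2) \/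
   u.1 = 3 * u.2 + 8 * v.2 /\ v.1 = 2 * u.2 + 3 * v.2)%N.

Lemma sol_link_norm u v : sol_link u v ->
  (u.1 ^ 2 + 7 * u.2 ^ 2 = 4 * (v.1 ^ 2 + 7 * v.2 ^ 2))%N.
Proof. by case: u v => m n [m' k]; rewrite /sol_link /=; nia. Qed.

Lemma sol_link_down u v : odd u.2 -> sol_link u v -> sol_down u = v.
Proof.
case: u v => m n [m' k]; rewrite /sol_link /= => on e; rewrite /sol_down /absdiff /=.
case: e => [[e1 [e2|e2]]|[[e1 [e2|e2]]|[e1 e2]]]; case: eqP => e'; try lia;
  try (case: leqP => e''; try lia); congr (_, _); lia.
Qed.

Lemma sol_link_up u v : odd u.2 -> odd v.2 -> sol_link u v -> sol_up v = u.
Proof.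
case: u v => m n [m' k]; rewrite /sol_link /= => on ok e; rewrite /sol_up /absdiff /=.
case: e => [[e1 [e2|e2]]|[[e1 [e2|e2]]|[e1 e2]]]; case: eqP => e'; try lia;
  try (case: leqP => e''; try lia); congr (_, _); lia.
Qed.

Lemma sol_downP N u : (N %% 32 = 0)%N -> sol N u ->
  sol (N %/ 4) (sol_down u) /\ sol_up (sol_down u) = u.
Proof.
case: u => m n N16; rewrite /sol => /and3P[]; rewrite !coprime6E /= => hm hn /eqP hN.
have om : odd m by lia. have on : odd n by lia.
have := odd_sqr_mod32 om; have := odd_sqr_mod32 on => sn sm.
(* Modulo 32, [m^2 = 25 n^2], so [m] is [5 n] or [- 5 n] modulo 16, and one of [m + 3 n], [m - 3 n]
   is 8 times an odd number. *)
have key : ((m + 3 * n) %% 16 = 8 \/ (m + 13 * n) %% 16 = 8)%N.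
  by move: hN sn sm N16; move: (m ^ 2)%N (n ^ 2)%N; clear; lia.
clear sn sm.
have [v [ok ud]] : exists v, odd v.2 /\ sol_link (m, n) v.
  rewrite /sol_link /=; clear -key on om; case: key => h.
    by exists (absdiff (2 * n) (3 * ((m + 3 * n) %/ 8)), (m + 3 * n) %/ 8)%N;
       rewrite /absdiff /=; lia.
  case: (leqP m (3 * n)) => h'.
    by exists (absdiff (2 * n) (3 * ((3 * n - m) %/ 8)), (3 * n - m) %/ 8)%N;
       rewrite /absdiff /=; lia.
  by exists (2 * n + 3 * ((m - 3 * n) %/ 8), (m - 3 * n) %/ 8)%N; rewrite /=; lia.
rewrite (sol_link_down _ ud) // (sol_link_up _ _ ud) //; split=> //.
have /= := sol_link_norm ud; rewrite hN => ->; rewrite mulKn // eqxx andbT.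
clear -ud hm hn ok om on; case: v ok ud => m' k; rewrite /sol_link /= => ok e.
by case: e => [[e1 [e2|e2]]|[[e1 [e2|e2]]|[e1 e2]]]; apply/andP; split; lia.
Qed.

Lemma sol_upP N v : sol N v -> sol (4 * N) (sol_up v) /\ sol_down (sol_up v) = v.
Proof.
case: v => m' k; rewrite /sol => /and3P[]; rewrite !coprime6E /= => hm hk /eqP hN.
have [u [on ud]] : exists u, odd u.2 /\ sol_link u (m', k).
  rewrite /sol_link /=; clear -hm hk.
  case: (boolP ((m' + 3 * k) %% 4 == 2)%N) => h.
    by exists (absdiff (8 * k) (3 * ((m' + 3 * k) %/ 2)), (m' + 3 * k) %/ 2)%N;
       rewrite /absdiff /=; lia.
  case: (leqP (3 * k) m') => h'.
    by exists (3 * ((m' - 3 * k) %/ 2) + 8 * k, (m' - 3 * k) %/ 2)%N; rewrite /=; lia.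
  by exists (absdiff (3 * ((3 * k - m') %/ 2)) (8 * k), (3 * k - m') %/ 2)%N;
     rewrite /absdiff /=; lia.
have ok : odd k by lia.
rewrite (sol_link_up _ _ ud) // (sol_link_down _ ud) //; split=> //.
have /= := sol_link_norm ud; rewrite hN => ->; rewrite eqxx andbT.
clear -ud hm hk ok on; case: u on ud => m n; rewrite /sol_link /= => on e.
by case: e => [[e1 [e2|e2]]|[[e1 [e2|e2]]|[e1 e2]]]; apply/andP; split; lia.
Qed.

Lemma sqr_coprime6_mod24 m : coprime m 6 -> (m ^ 2 %% 24 = 1)%N.
Proof.
rewrite coprime6E => hm; have -> : (m ^ 2 %% 24 = (m %% 12) ^ 2 %% 24)%N.
  rewrite {1}(divn_eq m 12).
  have -> : ((m %/ 12 * 12 + m %% 12) ^ 2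
    = (6 * (m %/ 12) ^ 2 + (m %/ 12) * (m %% 12)) * 24 + (m %% 12) ^ 2)%N by ring.
  by rewrite modnMDl.
have : (m %% 12 \in [:: 1; 5; 7; 11])%N by rewrite !inE; lia.
by rewrite !inE => /or4P[] /eqP ->.
Qed.

(** Squares of numbers coprime to 6 are 1 modulo 24. In particular [N] can only be 0, 8, 16 or 24
    modulo 32. *)
Lemma sol_mod24 N u : sol N u -> (N %% 24 = 8)%N.
Proof.
case: u => m n /and3P[/= /sqr_coprime6_mod24 + /sqr_coprime6_mod24 + /eqP].
by move: (m ^ 2)%N (n ^ 2)%N; clear; lia.
Qed.

(** * Coefficients of D(x) D(x^7) *)

Definition dilate (p : nat) (f : series 'F_2) : series 'F_2 :=
  Series (fun n => if (p %| n)%N then f (n %/ p)%N else 0).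

Definition decimate (p : nat) (f : series 'F_2) : series 'F_2 :=
  Series (fun n => f (p * n)%N).

Lemma heckeE p f : hecke p f = decimate p f + dilate p f.
Proof. by apply: seriesP. Qed.

Lemma coef_dilateM p f h n : (0 < p)%N ->
  (dilate p f * h) n = \sum_(j < (n %/ p).+1) f j * h (n - p * j)%N.
Proof.
move=> p0 /=.
rewrite -(big_mkord predT (fun i => (if (p %| i)%N then f (i %/ p)%N else 0) * h (n - i)%N)).
rewrite -(big_mkord predT (fun j => f j * h (n - p * j)%N)) /=.
rewrite (bigID (fun i => p %| i)%N) /= [X in _ + X]big1 ?addr0; last first.
  by move=> i /negbTE->; rewrite mul0r.
rewrite -big_filter.
have pe : perm_eq [seq i <- index_iota 0 n.+1 | (p %| i)%N]
    (map (muln p) (index_iota 0 (n %/ p).+1)).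
  apply: uniq_perm; rewrite ?filter_uniq ?iota_uniq //.
    by rewrite map_inj_uniq ?iota_uniq // => x y /eqP; rewrite eqn_pmul2l // => /eqP.
  move=> i; apply/idP/mapP; rewrite mem_filter mem_index_iota.
    case/andP=> /dvdnP[j ->] /= jn; exists j; last by rewrite mulnC.
    by rewrite mem_index_iota /= ltnS leq_divRL.
  case=> j; rewrite mem_index_iota /= ltnS leq_divRL // => jn ->.
  by rewrite dvdn_mulr // ltnS mulnC.
by rewrite (perm_big _ pe) big_map; apply: eq_bigr => j _; rewrite dvdn_mulr // mulKn.
Qed.

Lemma dilateM p f h : (0 < p)%N -> dilate p (f * h) = dilate p f * dilate p h.
Proof.
move=> p0; apply: seriesP => n; rewrite coef_dilateM //=.
case: ifP => [/dvdnP[m ->]|pn].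
  rewrite mulnK //; apply: eq_bigr => -[j jm] _ /=.
  by rewrite mulnC -mulnBr dvdn_mulr // mulKn.
rewrite big1 // => -[j /= jn] _; rewrite ltnS leq_divRL // mulnC in jn.
by rewrite dvdn_subl // ?pn ?mulr0 // dvdn_mulr.
Qed.

Lemma dilateX p f n : (0 < p)%N -> dilate p (f ^+ n) = dilate p f ^+ n.
Proof.
move=> p0; elim: n => [|n IH]; last by rewrite !exprS dilateM // IH.
apply: seriesP => i /=; case: ifP => [/dvdnP[j ->]|].
  by rewrite mulnK // muln_eq0 [p == 0%N]eqn0Ngt p0 orbF.
by case: i => //; rewrite dvdn0.
Qed.

(** Projection formula: [decimate p] is linear over the series in [x^p]. It is what turns relations
    between [X] and [Y] into recurrences for [T]. *)
Lemma decimate_dilateM p f h : (0 < p)%N ->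
  decimate p (dilate p f * h) = f * decimate p h.
Proof.
move=> p0; apply: seriesP => n; rewrite [LHS]/= -/(_ * _).
rewrite (_ : (\sum_(i < _) _) = (dilate p f * h) (p * n)%N) // coef_dilateM // mulKn //=.
by apply: eq_bigr => j _; rewrite mulnBr.
Qed.

Lemma decimateD p f h : decimate p (f + h) = decimate p f + decimate p h.
Proof. by apply: seriesP. Qed.

Lemma coef_theta_mul (I J : Type) (r : seq I) (s : seq J) (P : pred I) (Q : pred J)
    (a : I -> nat) (b : J -> nat) (f h : series 'F_2) N :
  (forall i, (i <= N)%N -> f i = \sum_(m <- r | P m) (a m == i)%:R) ->
  (forall i, (i <= N)%N -> h i = \sum_(n <- s | Q n) (b n == i)%:R) ->
  (f * h) N = \sum_(m <- r | P m) \sum_(n <- s | Q n) (a m + b n == N)%N%:R.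
Proof.
move=> fE hE /=.
transitivity (\sum_(i < N.+1) \sum_(m <- r | P m) \sum_(n <- s | Q n)
   (((a m == i) && (b n == N - i))%N%:R : 'F_2)).
  apply: eq_bigr => i _; rewrite fE 1?hE ?leq_subr //; last by rewrite -ltnS.
  rewrite big_distrl; apply: eq_bigr => m _; rewrite big_distrr; apply: eq_bigr => n _.
  by rewrite -mulnb natrM.
rewrite exchange_big; apply: eq_bigr => m _; rewrite exchange_big; apply: eq_bigr => n _.
case: (ltnP N (a m)) => aN.
  rewrite big1; last by move=> [i /= iN] _; case: eqP => // e; lia.
  by case: eqP => // e; lia.
rewrite (bigD1 (Ordinal (aN : (a m < N.+1)%N))) //= eqxx /= big1 ?addr0.
  by congr (_%:R); lia.
by move=> i /negbTE; rewrite -val_eqE /= eq_sym => ->.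
Qed.

(** Any cutoff beyond [n] gives the same sum, so one range can serve several coefficients; [m = 0]
    is excluded by coprimality to 6. *)
Lemma coef_D n K : (n < K)%N ->
  D n = \sum_(m <- index_iota 0 K | coprime m 6) (m ^ 2 == n)%N%:R.
Proof.
move=> nK /=.
rewrite -(big_mkord (fun m => [&& (0 < m)%N, coprime m 6 & (m ^ 2 == n)%N]) (fun=> 1)).
rewrite [RHS](big_cat_nat (n := n.+1)) //= [X in _ + X]big_seq_cond [X in _ + X]big1 ?addr0.
  rewrite [LHS]big_mkcond [RHS]big_mkcond /=; apply: eq_bigr => -[|m] _ //=.
  by case: (coprime _ _) => //; case: eqP.
move=> m /andP[]; rewrite mem_index_iota => hm _.
by case: eqP => // e; nia.
Qed.

Lemma coef_dilate_D p n K : (0 < p)%N -> (n < K)%N ->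
  dilate p D n = \sum_(m <- index_iota 0 K | coprime m 6) (p * m ^ 2 == n)%N%:R.
Proof.
move=> p0 nK; change (dilate p D n) with (if (p %| n)%N then D (n %/ p)%N else 0).
case: ifP => [/dvdnP[j ej]|pn].
  rewrite ej mulnK // (@coef_D j K); last by nia.
  by apply: eq_bigr => m _; rewrite mulnC eqn_pmul2r.
rewrite big1 // => m _; case: eqP => // e.
by rewrite -e dvdn_mulr in pn.
Qed.

Definition sols (N : nat) : seq (nat * nat) :=
  [seq u <- [seq (m, n) | m <- index_iota 0 N.+1, n <- index_iota 0 N.+1] | sol N u].

Lemma mem_sols N u : (u \in sols N) = sol N u.
Proof.
case: u => m n; rewrite mem_filter; case s: (sol N _) => //; rewrite andTb.
case/and3P: s => _ _ /eqP e; apply/allpairsP; exists (m, n); rewrite /= in e *.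
by split; rewrite //= mem_index_iota; nia.
Qed.

Lemma sols_uniq N : uniq (sols N).
Proof.
by rewrite filter_uniq // allpairs_uniq ?iota_uniq // => -[a b] [c d] _ _ /= [-> ->].
Qed.

Lemma coef_D_dilate7 N : (D * dilate 7 D) N = \sum_(u <- sols N) 1.
Proof.
rewrite (coef_theta_mul (fun i h => @coef_D i N.+1 h)
  (fun i h => @coef_dilate_D 7 i N.+1 isT h)).
rewrite /sols big_filter [RHS]big_mkcond big_allpairs /= [LHS]big_mkcond.
apply: eq_bigr => m _; rewrite big_mkcond /sol /=.
case: (coprime m 6) => /=; last by rewrite big1.
by apply: eq_bigr => n _; case: (coprime n 6) => //=; case: eqP.
Qed.

(** * The modular equation *)

Lemma dilate_dilate p q f : (0 < p)%N -> dilate p (dilate q f) = dilate (p * q) f.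
Proof.
move=> p0; apply: seriesP => n /=; case: (boolP (p %| n)%N) => [/dvdnP[m ->]|pn].
  by rewrite mulnK // mulnC dvdn_pmul2r // divnMr.
by case: ifP => // /(dvdn_trans (dvdn_mulr q (dvdnn p))); rewrite (negbTE pn).
Qed.

Lemma series_exp2X (f : series 'F_2) j : f ^+ (2 ^ j) = dilate (2 ^ j) f.
Proof.
elim: j => [|j IH]; first by apply: seriesP => n /=; rewrite dvd1n divn1.
rewrite expnS mulnC exprM IH mulnC -dilate_dilate //.
by apply: seriesP => n; rewrite series_sqrE.
Qed.

(** On the line [m = k n] the form equals [(k^2 + 7) n^2]: the cases [k = 1] and [k = 7] give the
    coefficients of [D(x^8)] and [D(x^56)]. *)
Lemma sols_diag N k : (0 < k)%N ->
  \sum_(u <- sols N | u.1 == (k * u.2)%N) 1 =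
  \sum_(m <- index_iota 0 N.+1 | coprime (k * m) 6)
    ((k ^ 2 + 7) * m ^ 2 == N)%N%:R :> 'F_2.
Proof.
move=> k0; transitivity (\sum_(m <- index_iota 0 N.+1 |
    coprime (k * m) 6 && ((k ^ 2 + 7) * m ^ 2 == N)%N) 1 : 'F_2); last first.
  by rewrite big_mkcondr; apply: eq_bigr => m _; case: eqP.
rewrite -big_filter -[RHS]big_filter.
set r := filter _ (index_iota _ _).
have pe : perm_eq [seq u <- sols N | u.1 == (k * u.2)%N] [seq ((k * m)%N, m) | m <- r].
  apply: uniq_perm; first by rewrite filter_uniq ?sols_uniq.
    by rewrite map_inj_uniq ?filter_uniq ?iota_uniq // => x y [_ ->].
  move=> [m n]; rewrite mem_filter mem_sols /sol /=.
  apply/andP/mapP => [[/eqP -> /and3P[h1 h2 /eqP h3]]|[n']].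
    exists n => //; rewrite mem_filter h1 mem_index_iota.
    by apply/andP; split; [apply/eqP|]; nia.
  rewrite mem_filter => /andP[/andP[h1 /eqP h2] _] [-> ->]; split=> //.
  rewrite h1 /=; apply/andP; split; last by apply/eqP; nia.
  by move: h1; rewrite coprimeMl => /andP[].
by rewrite (perm_big _ pe) big_map.
Qed.

Lemma modular_equation :
  D ^+ 8 + dilate 7 D ^+ 8 + D * dilate 7 D + (D * dilate 7 D) ^+ 4 = 0.
Proof.
rewrite (series_exp2X _ 3) (series_exp2X _ 3) (series_exp2X _ 2) dilate_dilate //.
apply: seriesP => N.
change (dilate 8 D N + dilate 56 D N + (D * dilate 7 D) N
  + (if (4 %| N)%N then (D * dilate 7 D) (N %/ 4)%N else 0) = 0).
rewrite !(@coef_dilate_D _ N N.+1) // !coef_D_dilate7.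
(* For [N = 8] modulo 16, [N / 4] is not represented, and [refl8] leaves the two lines matching
   [D(x^8)] and [D(x^56)]. *)
case: (boolP (N %% 16 == 8)%N) => [/eqP N8|N8].
  have -> : (if (4 %| N)%N then \sum_(u <- sols (N %/ 4)) 1 else 0) = 0 :> 'F_2.
    case: ifP => // N4; rewrite big_seq big1 // => u.
    by rewrite mem_sols => /sol_mod24; lia.
  rewrite addr0 (@big_involution _ (sols N) refl8) ?sols_uniq //; first last.
  - by move=> u; rewrite mem_sols => /(refl8P N8)[].
  - by move=> u; rewrite !mem_sols => /(refl8P N8)[].
  have -> : \sum_(u <- sols N | refl8 u == u) 1 =
     \sum_(u <- sols N | u.1 == (1 * u.2)%N) 1
     + \sum_(u <- sols N | u.1 == (7 * u.2)%N) 1 :> 'F_2.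
    rewrite [LHS]big_seq_cond [LHS](bigID (fun u => u.1 == u.2)).
    rewrite [X in _ = X + _]big_seq_cond [X in _ = _ + X]big_seq_cond.
    congr (_ + _); apply: eq_bigl => u; rewrite mem_sols; case s: (sol N u) => //=.
      by have [_ _ ->] := refl8P N8 s; rewrite mul1n; case: (u.1 == u.2) => //=; rewrite andbF.
    have [_ _ ->] := refl8P N8 s; case/and3P: s; rewrite !coprime6E; lia.
  rewrite !sols_diag //.
  under [X in _ + (X + _)]eq_bigl do rewrite mul1n.
  under [X in _ + (_ + X)]eq_bigl do rewrite coprimeMl /=.
  exact: addF2.
(* For other [N], the values [8 m^2] and [56 m^2] are missed, being 8 modulo 16. *)
rewrite [X in X + _ + _ + _]big1 ?add0r; last first.
  by move=> m /sqr_coprime6_mod24; case: eqP => //; move: (m ^ 2)%N => x; lia.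
rewrite [X in X + _ + _]big1 ?add0r; last first.
  by move=> m /sqr_coprime6_mod24; case: eqP => //; move: (m ^ 2)%N => x; lia.
(* For [N = 16] modulo 32, [refl16] has no fixed point, and [N / 4], being 4 modulo 8, is not
   represented. *)
case: (boolP (N %% 32 == 16)%N) => [/eqP N16|N16].
  rewrite (@big_involution _ (sols N) refl16) ?sols_uniq //; first last.
  - by move=> u; rewrite mem_sols => /(refl16P N16)[].
  - by move=> u; rewrite !mem_sols => /(refl16P N16)[].
  rewrite big_seq_cond big1 ?add0r; last first.
    by move=> u; rewrite mem_sols => /andP[/(refl16P N16)[_ _ /negbTE ->]].
  case: ifP => // N4; rewrite big_seq big1 // => u.
  by rewrite mem_sols => /sol_mod24; lia.
(* When 32 divides [N], [sol_down] is a bijection between the solutions for [N] and for [N / 4], so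
   the two counts cancel. *)
case: (boolP (N %% 32 == 0)%N) => [/eqP N32|N32].
  have -> : (4 %| N)%N by lia.
  have pe : perm_eq (map sol_down (sols N)) (sols (N %/ 4)).
    apply: uniq_perm; rewrite ?sols_uniq //.
      rewrite map_inj_in_uniq ?sols_uniq // => u v; rewrite !mem_sols.
      by move=> /(sol_downP N32)[_ eu] /(sol_downP N32)[_ ev] e; rewrite -eu e ev.
    move=> v; rewrite mem_sols; apply/mapP/idP => [[u]|sv].
      by rewrite mem_sols => /(sol_downP N32)[h _] ->.
    exists (sol_up v); last by have [_ ->] := sol_upP sv.
    rewrite mem_sols; have [+ _] := sol_upP sv.
    by have -> : (4 * (N %/ 4) = N)%N by lia.
  by rewrite -(perm_big _ pe) big_map addF2.
(* In the remaining classes neither [N] nor [N / 4] is 8 modulo 24. *)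
rewrite big_seq big1 ?add0r; last by move=> u; rewrite mem_sols => /sol_mod24; lia.
case: ifP => // N4; rewrite big_seq big1 // => u.
by rewrite mem_sols => /sol_mod24; lia.
Qed.

(** * Recurrences for T_7 *)

Lemma series_addr_eq0 (f h : series 'F_2) : f + h = 0 -> f = h.
Proof. by move=> e; rewrite -[f]addr0 -(addss h) addrA e add0r. Qed.

Lemma dilateD p f h : dilate p (f + h) = dilate p f + dilate p h.
Proof. by apply: seriesP => n /=; case: ifP; rewrite ?addr0. Qed.

Lemma series_exp2D (f h : series 'F_2) j :
  (f + h) ^+ (2 ^ j) = f ^+ (2 ^ j) + h ^+ (2 ^ j).
Proof. by rewrite !series_exp2X dilateD. Qed.

(** Squaring substitutes [x^2] for [x], which commutes with decimation and dilation by an odd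
    [p]. *)
Lemma hecke_sqr p f : odd p -> hecke p (f ^+ 2) = hecke p f ^+ 2.
Proof.
move=> op; apply: seriesP => n; rewrite series_sqrE /= -[(\sum_(i < _) _)]/((f ^+ 2) _).
rewrite -[(\sum_(i < (n %/ p).+1) _)]/((f ^+ 2) _) !series_sqrE.
have p0 : (0 < p)%N by case: p op.
have d2p : (2 %| p)%N = false by rewrite dvdn2 op.
rewrite Euclid_dvdM // d2p /=.
case: (boolP (2 %| n)%N) => [/dvdnP[m ->]|n2].
  rewrite mulnA !mulnK //; congr (_ + _).
  rewrite Gauss_dvdl ?coprimen2 //; case: ifP => // /dvdnP[k ->].
  by rewrite mulnAC !mulnK // dvdn_mull.
case: ifP => [/dvdnP[k ek]|]; last by rewrite addr0.
by move: n2; rewrite ek Euclid_dvdM // d2p orbF mulnK // => /negbTE ->; rewrite addr0.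
Qed.

Lemma hecke_exp2 p f j : odd p -> hecke p (f ^+ (2 ^ j)) = hecke p f ^+ (2 ^ j).
Proof.
by move=> op; elim: j => // j IH; rewrite expnS mulnC exprM hecke_sqr // IH -exprM.
Qed.

Lemma mul_hecke_D i j n : D ^+ i * hecke 7 (D ^+ (n + j)) =
  decimate 7 (D ^+ n * (D ^+ j * dilate 7 D ^+ i)) +
  dilate 7 D ^+ n * (D ^+ i * dilate 7 D ^+ j).
Proof.
rewrite heckeE mulrDr -decimate_dilateM // !dilateX // exprD.
by congr (_ + _); [congr decimate|rewrite exprD]; ring.
Qed.

Lemma decimate0 p : decimate p 0 = 0.
Proof. exact: seriesP. Qed.

(** The second hypothesis kills the decimated half of [T], through the projection formula, and the
    first kills the dilated half. For a relation symmetric in [X] and [Y] the two coincide. *)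
Lemma hecke_relation (s : seq (nat * nat)) n :
  \sum_(u <- s) D ^+ u.1 * dilate 7 D ^+ u.2 = 0 ->
  \sum_(u <- s) D ^+ u.2 * dilate 7 D ^+ u.1 = 0 ->
  \sum_(u <- s) D ^+ u.1 * hecke 7 (D ^+ (n + u.2)) = 0.
Proof.
move=> r1 r2; under eq_bigr do rewrite mul_hecke_D.
rewrite big_split /= -mulr_sumr r1 mulr0 addr0.
rewrite -(big_morph _ (decimateD 7) (decimate0 7)) -mulr_sumr r2 mulr0.
exact: decimate0.
Qed.

Lemma relation_exp2 (X Y : series 'F_2) a b c k :
  X ^+ a + Y ^+ a + X ^+ b * Y ^+ b + X ^+ c * Y ^+ c = 0 ->
  X ^+ (a * 2 ^ k) + Y ^+ (a * 2 ^ k) + X ^+ (b * 2 ^ k) * Y ^+ (b * 2 ^ k)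
    + X ^+ (c * 2 ^ k) * Y ^+ (c * 2 ^ k) = 0.
Proof.
move=> e; rewrite !exprM -(exprMn _ (X ^+ b)) -(exprMn _ (X ^+ c)).
by rewrite -!series_exp2D e expr0n expn_eq0.
Qed.

Lemma hecke_recurrence a b c n :
  D ^+ a + dilate 7 D ^+ a + D ^+ b * dilate 7 D ^+ b
    + D ^+ c * dilate 7 D ^+ c = 0 ->
  hecke 7 (D ^+ (n + a)) = D ^+ a * hecke 7 (D ^+ n)
  + D ^+ b * hecke 7 (D ^+ (n + b)) + D ^+ c * hecke 7 (D ^+ (n + c)).
Proof.
move=> R; apply: series_addr_eq0.
have := @hecke_relation [:: (0%N, a); (a, 0%N); (b, b); (c, c)] n.
rewrite !big_cons !big_nil /= !expr0 !mul1r !mulr1 !addr0 addn0 -!addrA; apply.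
  by rewrite addrCA !addrA.
by rewrite !addrA.
Qed.

Lemma hecke_rec8 k n : let q := (2 ^ k)%N in
  hecke 7 (D ^+ (n + 8 * q)) = D ^+ (8 * q) * hecke 7 (D ^+ n)
  + D ^+ (1 * q) * hecke 7 (D ^+ (n + 1 * q))
  + D ^+ (4 * q) * hecke 7 (D ^+ (n + 4 * q)).
Proof.
move=> q; apply/hecke_recurrence/relation_exp2.
by rewrite !expr1 -exprMn; exact: modular_equation.
Qed.

Lemma series_mulr2n (f : series 'F_2) : f *+ 2 = 0.
Proof. by rewrite mulr2n addss. Qed.

(** This is [A^3 + B^3 = (A + B)^3 - 3 A B (A + B)] with [A = X^8], [B = Y^8], where
    [A + B = C + C^4] for [C = X Y]. *)
Lemma modular_equation24 :
  D ^+ 24 + dilate 7 D ^+ 24 + D ^+ 3 * dilate 7 D ^+ 3 + D ^+ 6 * dilate 7 D ^+ 6 = 0.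
Proof.
have := modular_equation; move: D (dilate 7 D) => X Y.
rewrite -addrA => /series_addr_eq0 R.
set C := X * Y in R.
have -> : X ^+ 24 + Y ^+ 24 + X ^+ 3 * Y ^+ 3 + X ^+ 6 * Y ^+ 6 =
  (X ^+ 8 + Y ^+ 8) ^+ 3 - C ^+ 8 * (X ^+ 8 + Y ^+ 8) *+ 3 + C ^+ 3 + C ^+ 6.
  by rewrite /C; ring.
(* Expanded over the integers, the left side is twice this polynomial in [C]. *)
rewrite R -(series_mulr2n (C ^+ 3 + C ^+ 6 *+ 2 - C ^+ 12)).
by ring.
Qed.

Lemma hecke_rec24 k n : let q := (2 ^ k)%N in
  hecke 7 (D ^+ (n + 24 * q)) = D ^+ (24 * q) * hecke 7 (D ^+ n)
  + D ^+ (3 * q) * hecke 7 (D ^+ (n + 3 * q))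
  + D ^+ (6 * q) * hecke 7 (D ^+ (n + 6 * q)).
Proof.
move=> q; apply/hecke_recurrence/relation_exp2; exact: modular_equation24.
Qed.

(** * Orders of vanishing of power series *)

Lemma coef_mul_ord (f h : series 'F_2) a b :
  (forall i, (i < a)%N -> f i = 0) -> (forall i, (i < b)%N -> h i = 0) ->
  (forall i, (i < a + b)%N -> (f * h) i = 0) /\ (f * h) (a + b)%N = f a * h b.
Proof.
move=> fa hb; split=> [n nab|] /=.
  rewrite big1 // => -[i /= ni] _; case: (ltnP i a) => ia; first by rewrite fa ?mul0r.
  by rewrite hb ?mulr0 //; lia.
have lt_a : (a < (a + b).+1)%N by lia.
rewrite (bigD1 (Ordinal lt_a)) //= addKn big1 ?addr0 // => -[i /= ni].
rewrite -val_eqE /= => ia; case: (ltngtP i a) ia => // ia _; first by rewrite fa ?mul0r.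
by rewrite hb ?mulr0 //; lia.
Qed.

Lemma coef_exp_ord (f : series 'F_2) n : f 0%N = 0 -> f 1%N = 1 ->
  (forall i, (i < n)%N -> (f ^+ n) i = 0) /\ (f ^+ n) n = 1.
Proof.
move=> f0 f1; elim: n => [|n [IH0 IH1]]; first by split.
have f0' i : (i < 1)%N -> f i = 0 by case: i.
have [] := coef_mul_ord f0' IH0; rewrite -exprS add1n => h0 h1.
by split=> //; rewrite h1 f1 IH1 mulr1.
Qed.

Lemma ord1_mul_eq0 (w f : series 'F_2) :
  w 0%N = 0 -> w 1%N = 1 -> w * f = 0 -> f = 0.
Proof.
move=> w0 w1 wf.
have w0' i : (i < 1)%N -> w i = 0 by case: i.
suff h n : forall i, (i < n)%N -> f i = 0 by apply: seriesP => n; apply: (h n.+1).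
elim: n => // n IH i; rewrite ltnS leq_eqVlt => /orP[/eqP ->|]; last exact: IH.
by have [_] := coef_mul_ord w0' IH; rewrite wf w1 mul1r.
Qed.

(** * Initial values *)

(** If [m^2 = 7 n] then [m = 7 l] and [n = 7 l^2], so the decimation of [D] equals [D(x^7)] and the
    two halves of [T] cancel. *)
Lemma hecke7_D : hecke 7 D = 0.
Proof.
apply: seriesP => n; change (D (7 * n)%N + dilate 7 D n = 0).
rewrite (@coef_D _ (7 * n).+1) // (@coef_dilate_D 7 n (7 * n).+1) //; last by lia.
suff -> : \sum_(m <- index_iota 0 (7 * n).+1 | coprime m 6) (m ^ 2 == 7 * n)%N%:R =
   \sum_(m <- index_iota 0 (7 * n).+1 | coprime m 6) (7 * m ^ 2 == n)%N%:R :> 'F_2.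
  exact: addF2.
have e (Q : pred nat) : \sum_(m <- index_iota 0 (7 * n).+1 | coprime m 6) (Q m)%:R =
    \sum_(m <- [seq m <- index_iota 0 (7 * n).+1 | coprime m 6 && Q m]) 1 :> 'F_2.
  by rewrite big_filter big_mkcondr; apply: eq_bigr => m _; case: (Q m).
rewrite !e; set s := [seq m <- _ | _]; set t := [seq m <- _ | _].
have pe : perm_eq s (map (muln 7) t).
  apply: uniq_perm; first by rewrite filter_uniq ?iota_uniq.
    by rewrite map_inj_uniq ?filter_uniq ?iota_uniq // => x y /eqP; rewrite eqn_pmul2l // => /eqP.
  move=> m; apply/idP/mapP; rewrite mem_filter mem_index_iota.
    case/andP=> /andP[c6 /eqP sq] mn.
    have /dvdnP[l el] : (7 %| m)%N.
      have : (7 %| m ^ 2)%N by rewrite sq dvdn_mulr.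
      by rewrite Euclid_dvdX // => /andP[].
    rewrite {m}el mulnC coprimeMl /= in c6 sq mn *.
    by exists l => //; rewrite mem_filter mem_index_iota c6 /=; apply/andP; split; [apply/eqP|]; nia.
  case=> l; rewrite mem_filter mem_index_iota => /andP[/andP[c6 /eqP sq] ln] ->.
  rewrite coprimeMl c6 /=; apply/andP; split; [apply/eqP|]; nia.
by rewrite (perm_big _ pe) big_map.
Qed.

Lemma D_coef0 : D 0%N = 0.
Proof. by rewrite (@coef_D 0 1) // big_cons big_nil. Qed.

Lemma D_coef1 : D 1%N = 1.
Proof. by rewrite (@coef_D 1 2) // !big_cons big_nil /= addr0. Qed.

(* If x^v is the lowest term of p, then D^3 p has order v + 3, which differs from
   8 v and is less than 2 v + 6. *)
Lemma series_eq0_of_rel (p : series 'F_2) :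
  p ^+ 8 = D ^+ 3 * p + D ^+ 6 * p ^+ 2 -> p = 0.
Proof.
move=> e; suff h n : forall i, (i < n)%N -> p i = 0.
  by apply: seriesP => n; apply: (h n.+1).
elim: n => // n IH i; rewrite ltnS leq_eqVlt => /orP[/eqP ->|]; last exact: IH.
have IH2 j : (j < n)%N -> (p ^+ 2) j = 0.
  by move=> jn; rewrite series_sqrE; case: ifP => // _; apply: IH; lia.
have [o3 c3] := coef_exp_ord 3 D_coef0 D_coef1.
have [o6 _] := coef_exp_ord 6 D_coef0 D_coef1.
have [_ h3] := coef_mul_ord o3 IH; have [h6 _] := coef_mul_ord o6 IH2.
have := congr1 (fun f : series 'F_2 => f (3 + n)%N) e.
change ((p ^+ 8) (3 + n)%N = (D ^+ 3 * p) (3 + n)%N + (D ^+ 6 * p ^+ 2) (3 + n)%N -> p n = 0).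
rewrite h3 c3 mul1r h6 ?ltn_add2r // addr0 => <-.
rewrite (series_exp2X p 3); change ((if (8 %| 3 + n)%N then p ((3 + n) %/ 8)%N else 0) = 0).
by case: ifP => // d8; apply: IH; lia.
Qed.

Definition hecke_pow n : series 'F_2 := hecke 7 (D ^+ n).

Lemma hecke_pow_exp2 n k : hecke_pow (n * 2 ^ k) = hecke_pow n ^+ (2 ^ k).
Proof. by rewrite /hecke_pow exprM hecke_exp2. Qed.

Lemma hecke_pow1_0 : hecke_pow 1 = 0. Proof. by rewrite /hecke_pow expr1 hecke7_D. Qed.

Lemma hecke_pow_exp2_0 n k : hecke_pow n = 0 -> hecke_pow (n * 2 ^ k) = 0.
Proof. by move=> e; rewrite hecke_pow_exp2 e expr0n expn_eq0. Qed.

Lemma hecke_pow_rec8 n : hecke_pow (n + 8) =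
  D ^+ 8 * hecke_pow n + D * hecke_pow (n + 1) + D ^+ 4 * hecke_pow (n + 4).
Proof. exact: (hecke_rec8 0 n). Qed.

Lemma hecke_pow_rec16 n : hecke_pow (n + 16) =
  D ^+ 16 * hecke_pow n + D ^+ 2 * hecke_pow (n + 2) + D ^+ 8 * hecke_pow (n + 8).
Proof. exact: (hecke_rec8 1 n). Qed.

(** With [p = T(X^3)], the recurrence at [n = 4] and [n = 2] gives [p^4 = D T(X^5)] and
    [T(X^5)^2 = D p + D^4 p^2]. Eliminating [T(X^5)] yields the relation of [series_eq0_of_rel]. *)
Lemma hecke_pow3_powT5 : hecke_pow 3 = 0 /\ hecke_pow 5 = 0.
Proof.
have h2 : hecke_pow 2 = 0 := hecke_pow_exp2_0 1 hecke_pow1_0.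
have h4 : hecke_pow 4 = 0 := hecke_pow_exp2_0 2 hecke_pow1_0.
have h8 : hecke_pow 8 = 0 := hecke_pow_exp2_0 3 hecke_pow1_0.
have h6 : hecke_pow 6 = hecke_pow 3 ^+ 2 := hecke_pow_exp2 3 1.
have h10 : hecke_pow 10 = hecke_pow 5 ^+ 2 := hecke_pow_exp2 5 1.
have h12 : hecke_pow 12 = hecke_pow 3 ^+ 4 := hecke_pow_exp2 3 2.
have := hecke_pow_rec8 4; rewrite h12 h4 h8 !mulr0 add0r addr0 => e4.
have := hecke_pow_rec8 2; rewrite h10 h2 h6 !mulr0 add0r => e2.
have e3 : hecke_pow 3 = 0.
  apply: series_eq0_of_rel; move: D e4 e2 => X e4 e2.
  have -> : hecke_pow 3 ^+ 8 = (hecke_pow 3 ^+ 4) ^+ 2 by rewrite -exprM.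
  by rewrite e4 exprMn e2; ring.
split=> //; apply: (ord1_mul_eq0 D_coef0 D_coef1).
by rewrite -[LHS]e4 e3 expr0n.
Qed.

(** The recurrence at [n = 6] reads [P^2 = D P] for [P = T(X^7)]; since [P] has order 1, it can be
    cancelled. *)
Lemma hecke_pow7 : hecke_pow 7 = D.
Proof.
have [h3 h5] := hecke_pow3_powT5.
have h6 : hecke_pow 6 = 0 := hecke_pow_exp2_0 1 h3.
have h10 : hecke_pow 10 = 0 := hecke_pow_exp2_0 1 h5.
have h14 : hecke_pow 14 = hecke_pow 7 ^+ 2 := hecke_pow_exp2 7 1.
have := hecke_pow_rec8 6; rewrite h14 h6 h10 !mulr0 add0r addr0 => e.
apply: series_addr_eq0; apply: (@ord1_mul_eq0 (hecke_pow 7)).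
- exact: addF2.
- change ((D ^+ 7) 7%N + 0 = 1).
  by have [_ ->] := coef_exp_ord 7 D_coef0 D_coef1; rewrite addr0.
- by rewrite mulrDr -expr2 e mulrC addss.
Qed.

(** * Leading terms *)

Definition mon (m : nat) : series 'F_2 := D ^+ (5 + 6 * m).

Lemma monM j m : D ^+ (6 * j) * mon m = mon (m + j).
Proof. by rewrite /mon -exprD; congr (_ ^+ _); lia. Qed.

Definition in_span (P : pred nat) (f : series 'F_2) : Prop :=
  exists2 s : seq nat, all P s & f = \sum_(u <- s) mon u.

Lemma in_span0 P : in_span P 0.
Proof. by exists [::]; rewrite ?big_nil. Qed.

Lemma in_spanD P f h : in_span P f -> in_span P h -> in_span P (f + h).
Proof.
by move=> [s ps ->] [t pt ->]; exists (s ++ t); rewrite ?all_cat ?ps // big_cat.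
Qed.

Lemma in_span_mon (P : pred nat) m : P m -> in_span P (mon m).
Proof. by move=> pm; exists [:: m]; rewrite ?big_seq1 //= pm. Qed.

Lemma in_spanM (P Q : pred nat) j f : (forall u, P u -> Q (u + j)%N) ->
  in_span P f -> in_span Q (D ^+ (6 * j) * f).
Proof.
move=> PQ [s /allP ps ->]; exists [seq (u + j)%N | u <- s].
  by apply/allP => _ /mapP[u /ps pu ->]; apply: PQ.
by rewrite big_map mulr_sumr; apply: eq_bigr => u _; rewrite monM.
Qed.

(* Membership in [low m] reads (a' + 1, b') < (a, b), so it already excludes the leading
   index (a - 1, b) of the image of [mon m]. *)
Definition low (m u : nat) : bool :=
  earlier ((ebits u).+1, obits u) (ebits m, obits m).

(** The value 0 for [a = 0] lets [has_lead] carry both claims of the theorem through a single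
    induction. *)
Definition lead (m : nat) : series 'F_2 :=
  if ebits m == 0%N then 0 else mon (code (ebits m - 1) (obits m)).

Definition has_lead (m : nat) : Prop := in_span (low m) (hecke 7 (mon m) + lead m).

Lemma has_lead_of_eq m f : in_span (low m) f -> hecke 7 (mon m) = lead m + f -> has_lead m.
Proof. by move=> h e; rewrite /has_lead e addrAC addss add0r. Qed.

(** Subadditivity of the digits keeps the error terms low after multiplication by [t^j]. *)
Lemma has_lead_mul m j n :
  lexle (ebits m + ebits j, obits m + obits j)%N (ebits n, obits n) ->
  has_lead m -> in_span (low n) (D ^+ (6 * j) * hecke 7 (mon m) + D ^+ (6 * j) * lead m).
Proof.
move=> le hm; rewrite -mulrDr; apply: in_spanM hm => u; rewrite /low.
have := bits_add u j; move: le; rewrite /lexle /earlier /=; lia.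
Qed.

Lemma lead_mul_low m j n :
  (let u := code (ebits m - 1) (obits m) in
   (0 < ebits m)%N -> ebits u = (ebits m - 1)%N -> obits u = obits m ->
   low n (u + j)) ->
  in_span (low n) (D ^+ (6 * j) * lead m).
Proof.
move=> h; rewrite /lead; case: eqP => [_|/eqP e0]; first by rewrite mulr0; apply: in_span0.
rewrite monM; apply: in_span_mon; have [eu ou] := bits_of_code (ebits m - 1) (obits m).
by apply: h; rewrite ?lt0n.
Qed.

Lemma lead_mul_eq m j n : (0 < ebits m)%N ->
  (let u := code (ebits m - 1) (obits m) in
   ebits u = (ebits m - 1)%N -> obits u = obits m ->
   (ebits (u + j)).+1 = ebits n /\ obits (u + j) = obits n) ->
  D ^+ (6 * j) * lead m = lead n.
Proof.
move=> m0 h; have [eu ou] := bits_of_code (ebits m - 1) (obits m).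
have [e o] := h eu ou.
rewrite /lead [ebits m == _]eqn0Ngt m0 -e -o /= subSS subn0 monM.
by congr mon; rewrite [RHS]/code bits_code.
Qed.

(** * The induction step: comparing leading monomials in the recurrence *)

Lemma hecke_mon_rec m k : let q := (2 ^ k)%N in
  hecke 7 (mon (m + 8 * q)) = D ^+ (6 * (8 * q)) * hecke 7 (mon m)
  + D ^+ (6 * q) * hecke 7 (mon (m + q)) + D ^+ (6 * (2 * q)) * hecke 7 (mon (m + 2 * q)).
Proof.
(* Using the power [2^(k+1) = 2 q] makes all exponents multiples of 6, that is, powers of [t]. *)
move=> q; have := hecke_rec24 k.+1 (5 + 6 * m); rewrite /= -/q /mon.
have -> : (5 + 6 * m + 24 * 2 ^ k.+1 = 5 + 6 * (m + 8 * q))%N by rewrite /q expnS; lia.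
have -> : (5 + 6 * m + 3 * 2 ^ k.+1 = 5 + 6 * (m + q))%N by rewrite /q expnS; lia.
have -> : (5 + 6 * m + 6 * 2 ^ k.+1 = 5 + 6 * (m + 2 * q))%N by rewrite /q expnS; lia.
have -> : (24 * 2 ^ k.+1 = 6 * (8 * q))%N by rewrite /q expnS; lia.
have -> : (3 * 2 ^ k.+1 = 6 * q)%N by rewrite /q expnS; lia.
by have -> : (6 * 2 ^ k.+1 = 6 * (2 * q))%N by rewrite /q expnS; lia.
Qed.

Lemma has_lead_step m k q n : q = (2 ^ k)%N -> n = (m + 8 * q)%N ->
  has_lead m -> has_lead (m + q) -> has_lead (m + 2 * q) ->
  lexle (ebits m + ebits (8 * q), obits m + obits (8 * q))%N (ebits n, obits n) ->
  lexle (ebits (m + q) + ebits q, obits (m + q) + obits q)%N (ebits n, obits n) ->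
  lexle (ebits (m + 2 * q) + ebits (2 * q), obits (m + 2 * q) + obits (2 * q))%N
    (ebits n, obits n) ->
  in_span (low n) (D ^+ (6 * (8 * q)) * lead m + D ^+ (6 * q) * lead (m + q)
    + D ^+ (6 * (2 * q)) * lead (m + 2 * q) + lead n) ->
  has_lead n.
Proof.
move=> eq en h1 h2 h3 l1 l2 l3 hl.
have s1 := has_lead_mul l1 h1; have s2 := has_lead_mul l2 h2; have s3 := has_lead_mul l3 h3.
have alg (a1 a2 a3 b1 b2 b3 l : series 'F_2) :
    a1 + b1 + (a2 + b2) + (a3 + b3) + (b1 + b2 + b3 + l) = a1 + a2 + a3 + l.
  rewrite -[RHS]addr0 -(series_mulr2n (b1 + b2 + b3)); ring.
have := in_spanD (in_spanD (in_spanD s1 s2) s3) hl; rewrite alg.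
by have := hecke_mon_rec m k; rewrite /= -eq -en /has_lead => ->.
Qed.

(** Here [q = 4^k], and the new digit, of odd rank, adds [2^(k+1)] to [b]. The leading monomial
    comes from [t^(8q) T(X^5 t^m)]. *)
Lemma has_lead_step_even m k : (m < 2 * 4 ^ k.+1)%N ->
  has_lead m -> has_lead (m + 4 ^ k) -> has_lead (m + 2 * 4 ^ k) ->
  has_lead (m + 2 * 4 ^ k.+1).
Proof.
move=> mk h1 h2 h3.
have e4 : (2 ^ (2 * k) = 4 ^ k)%N by rewrite expnM.
have := @has_lead_step m (2 * k) (4 ^ k) (m + 2 * 4 ^ k.+1).
have -> : (8 * 4 ^ k = 2 * 4 ^ k.+1)%N by rewrite expnS; lia.
have nob : ~~ odd (obits m %/ 2 ^ k.+1) by rewrite odd_obits_div divn_small.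
have [-> ->] := bits_add2X4 nob.
have [-> ->] := bits_2X4 k.+1; have [-> ->] := bits_2X4 k; have [-> ->] := bits_X4 k.
have s1 := bits_add m (4 ^ k); have s2 := bits_add m (2 * 4 ^ k).
have E := bits_X4 k; have E2 := bits_2X4 k.
rewrite (proj1 E) (proj2 E) in s1; rewrite (proj1 E2) (proj2 E2) in s2.
have p0 : (0 < 2 ^ k)%N by rewrite expn_gt0.
move=> /(_ (esym e4) erefl h1 h2 h3); apply.
- by rewrite /lexle /earlier /=; lia.
- by move: s1; rewrite /lexle /earlier /= expnS; lia.
- by move: s2; rewrite /lexle /earlier /= expnS; lia.
rewrite -!addrA addrCA; apply: in_spanD.
  (* Term in [t^q]: its sum may reach that of the leading index for [n], but then [obits] is too
     small. *)
  apply: lead_mul_low => u m0 eu ou; rewrite /low; have [-> ->] := bits_add2X4 nob.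
  have := bits_add u (4 ^ k); rewrite (proj1 E) (proj2 E) eu ou.
  by move: s1; rewrite /lexle /earlier /= expnS; lia.
rewrite addrCA; apply: in_spanD.
  (* Term in [t^(2q)]: of the two additions of [2 * 4^k], one must carry, which makes the bound
     strict. *)
  apply: lead_mul_low => u m0 eu ou; rewrite /low; have [-> ->] := bits_add2X4 nob.
  case: (boolP (odd (obits m %/ 2 ^ k))) => ob.
    have := bits_add u (2 * 4 ^ k); rewrite (proj1 E2) (proj2 E2) eu ou.
    by have := bits_add2X4_carry ob; rewrite /lexle /earlier /= expnS; lia.
  have [em om] := bits_add2X4 ob.
  have : odd (obits u %/ 2 ^ k).
    by rewrite ou om divnDr // divnn p0 addn1.
  move=> /bits_add2X4_carry; rewrite eu ou em om /earlier /= expnS.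
  by move: m0; rewrite em; lia.
have [m0|m0] := posnP (ebits m).
  by rewrite /lead (proj1 (bits_add2X4 nob)) m0 /= mulr0 addr0; apply: in_span0.
rewrite (@lead_mul_eq m (2 * 4 ^ k.+1) (m + 2 * 4 ^ k.+1) m0).
  by rewrite addss; apply: in_span0.
move=> u eu ou; have [-> ->] := bits_add2X4 nob.
have nou : ~~ odd (obits u %/ 2 ^ k.+1) by rewrite ou.
by have [-> ->] := bits_add2X4 nou; rewrite eu ou; split; lia.
Qed.

(** Here [q = 2 * 4^k], and the new digit, of even rank, adds [2^(k+2)] to [a]. The source of the
    leading monomial depends on whether [m] has [a = 0]. *)
Lemma has_lead_step_odd m k : (m < 4 ^ k.+2)%N ->
  has_lead m -> has_lead (m + 2 * 4 ^ k) -> has_lead (m + 4 ^ k.+1) ->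
  has_lead (m + 4 ^ k.+2).
Proof.
move=> mk h1 h2 h3.
have e4 : (2 ^ (2 * k).+1 = 2 * 4 ^ k)%N by rewrite expnS expnM.
have := @has_lead_step m (2 * k).+1 (2 * 4 ^ k) (m + 4 ^ k.+2).
have -> : (8 * (2 * 4 ^ k) = 4 ^ k.+2)%N by rewrite !expnS; lia.
have -> : (2 * (2 * 4 ^ k) = 4 ^ k.+1)%N by rewrite !expnS; lia.
have ltm : (ebits m < 2 ^ k.+2)%N.
  by rewrite -[X in (_ < X)%N]mul1n -ltn_divLR ?expn_gt0 // -ebits_div divn_small.
have nob : ~~ odd (ebits m %/ 2 ^ k.+2) by rewrite odd_ebits_div divn_small.
have [-> ->] := bits_addX4 nob.
have [-> ->] := bits_X4 k.+2; have [-> ->] := bits_X4 k.+1; have [-> ->] := bits_2X4 k.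
have s1 := bits_add m (2 * 4 ^ k); have s2 := bits_add m (4 ^ k.+1).
have E := bits_X4 k.+1; have E2 := bits_2X4 k.
rewrite (proj1 E) (proj2 E) in s2; rewrite (proj1 E2) (proj2 E2) in s1.
have p0 : (0 < 2 ^ k)%N by rewrite expn_gt0.
have x1 : (2 ^ k.+1 = 2 * 2 ^ k)%N by rewrite expnS.
have x2 : (2 ^ k.+2 = 4 * 2 ^ k)%N by rewrite !expnS mulnA.
move=> /(_ (esym e4) erefl h1 h2 h3); apply.
- by rewrite /lexle /earlier /=; lia.
- by move: s1; rewrite /lexle /earlier /= x2; lia.
- by move: s2; rewrite /lexle /earlier /= x1 x2; lia.
rewrite -!addrA addrCA; apply: in_spanD.
  (* Term in [t^q]: two digits of odd rank add at most [2^(k+1)] to the sum, against [2^(k+2)] for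
     [n]. *)
  apply: lead_mul_low => u m0 eu ou; rewrite /low; have [-> ->] := bits_addX4 nob.
  have := bits_add u (2 * 4 ^ k); rewrite (proj1 E2) (proj2 E2) eu ou.
  by move: s1; rewrite /lexle /earlier /= x2; lia.
(* If [a = 0], the leading monomial comes from [t^(2q)]: subtracting 1 from [2^(k+1)] clears its
   bit, so [4^(k+1)] is added back without carry. *)
have [m0|m0] := posnP (ebits m).
  rewrite {1}/lead m0 /= mulr0 add0r.
  have nok : ~~ odd (ebits m %/ 2 ^ k.+1) by rewrite m0 div0n.
  have [em om] := bits_addX4 nok.
  have m1 : (0 < ebits (m + 4 ^ k.+1))%N by rewrite em x1; lia.
  rewrite (@lead_mul_eq (m + 4 ^ k.+1) (4 ^ k.+1) (m + 4 ^ k.+2) m1).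
    by rewrite addss; apply: in_span0.
  move=> u eu ou; have [-> ->] := bits_addX4 nob.
  have nou : ~~ odd (ebits u %/ 2 ^ k.+1) by rewrite eu em m0 divn_small // x1; lia.
  by have [-> ->] := bits_addX4 nou; rewrite eu ou em om m0 x1 x2; split; lia.
rewrite addrCA; apply: in_spanD.
  apply: lead_mul_low => u m0' eu ou; rewrite /low; have [-> ->] := bits_addX4 nob.
  (* If [a > 0], some addition of [4^(k+1)] carries: when [m] lacks this digit, [a - 1 + 2^(k+1)]
     still contains it. *)
  case: (boolP (odd (ebits m %/ 2 ^ k.+1))) => ob.
    have := bits_add u (4 ^ k.+1); rewrite (proj1 E) (proj2 E) eu ou.
    by have := bits_addX4_carry ob; rewrite /lexle /earlier /= x1 x2; lia.
  have [em om] := bits_addX4 ob.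
  have lt1 : (ebits m < 2 ^ k.+1)%N.
    have : (ebits m %/ 2 ^ k.+1 < 2)%N by rewrite ltn_divLR ?expn_gt0 // -expnS.
    rewrite -[X in _ -> (_ < X)%N]mul1n -ltn_divLR ?expn_gt0 //.
    by case: (ebits m %/ 2 ^ k.+1)%N ob => [|[|]].
  have : odd (ebits u %/ 2 ^ k.+1).
    have -> : ebits u = (ebits m - 1 + 2 ^ k.+1)%N by rewrite eu em; lia.
    by rewrite divnDr // divnn expn_gt0 divn_small // ; lia.
  move=> /bits_addX4_carry; rewrite eu ou em om /earlier /= x1 x2.
  by lia.
rewrite (@lead_mul_eq m (4 ^ k.+2) (m + 4 ^ k.+2) m0).
  by rewrite addss; apply: in_span0.
move=> u eu ou; have [-> ->] := bits_addX4 nob.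
have nou : ~~ odd (ebits u %/ 2 ^ k.+2) by rewrite eu divn_small //; lia.
by have [-> ->] := bits_addX4 nou; rewrite eu ou; split; lia.
Qed.

(** * Base cases and the induction *)

Lemma hecke_pow_mod6_small :
  [/\ hecke_pow 5 = 0, hecke_pow 11 = D ^+ 5, hecke_pow 17 = 0 & hecke_pow 23 = D ^+ 17] /\
  [/\ hecke_pow 29 = D ^+ 11, hecke_pow 35 = D ^+ 29 + D ^+ 5, hecke_pow 41 = D ^+ 23
    & hecke_pow 47 = D ^+ 41 + D ^+ 17].
Proof.
have [h3 h5] := hecke_pow3_powT5; have h7 := hecke_pow7; have h1 := hecke_pow1_0.
have h2 : hecke_pow 2 = 0 := hecke_pow_exp2_0 1 h1.
have h4 : hecke_pow 4 = 0 := hecke_pow_exp2_0 2 h1.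
have h6 : hecke_pow 6 = 0 := hecke_pow_exp2_0 1 h3.
have h8 : hecke_pow 8 = 0 := hecke_pow_exp2_0 3 h1.
have h12 : hecke_pow 12 = 0 := hecke_pow_exp2_0 2 h3.
have h14 : hecke_pow 14 = hecke_pow 7 ^+ 2 := hecke_pow_exp2 7 1.
have h20 : hecke_pow 20 = 0 := hecke_pow_exp2_0 2 h5.
rewrite h7 in h14; move: hecke_pow hecke_pow_rec8 hecke_pow_rec16 h1 h2 h3 h4 h5 h6 h7 h8 h12 h14 h20.
move: D => X p r8 r16 h1 h2 h3 h4 h5 h6 h7 h8 h12 h14 h20.
(* Doubled terms that must cancel are supplied as [f + f]; the remaining identities hold in any
   commutative ring. *)
have c2 (f : series 'F_2) : f + f = 0 := addss f.
have h9 : p 9%N = 0 by have := r8 1%N; rewrite h1 h2 h5 !mulr0 !addr0.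
have h11 : p 11%N = X ^+ 5.
  by have := r8 3%N; rewrite h3 h4 h7 !mulr0 !add0r => ->; ring.
have h13 : p 13%N = 0 by have := r8 5%N; rewrite h5 h6 h9 !mulr0 !addr0.
have h15 : p 15%N = 0.
  have := r8 7%N; rewrite h7 h8 h11 mulr0 addr0 => ->.
  by rewrite -(c2 (X ^+ 9)); ring.
have h17 : p 17%N = 0 by have := r16 1%N; rewrite h1 h3 h9 !mulr0 !addr0.
have h19 : p 19%N = X ^+ 13.
  by have := r8 11%N; rewrite h11 h12 h15 !mulr0 !addr0 => ->; ring.
have h21 : p 21%N = X ^+ 3.
  by have := r8 13%N; rewrite h13 h14 h17 !mulr0 addr0 add0r => ->; ring.
have h23 : p 23%N = X ^+ 17.
  by have := r16 7%N; rewrite h7 h9 h15 !mulr0 !addr0 => ->; ring.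
have h25 : p 25%N = X ^+ 7.
  by have := r16 9%N; rewrite h9 h11 h17 !mulr0 addr0 add0r => ->; ring.
have h27 : p 27%N = 0.
  have := r8 19%N; rewrite h19 h20 h23 mulr0 addr0 => ->.
  by rewrite -(c2 (X ^+ 21)); ring.
have h29 : p 29%N = X ^+ 11.
  by have := r16 13%N; rewrite h13 h15 h21 !mulr0 !add0r => ->; ring.
have h31 : p 31%N = X ^+ 25.
  by have := r16 15%N; rewrite h15 h17 h23 !mulr0 !add0r => ->; ring.
have h33 : p 33%N = 0.
  have := r16 17%N; rewrite h17 h19 h25 mulr0 add0r => ->.
  by rewrite -(c2 (X ^+ 15)); ring.
have h35 : p 35%N = X ^+ 29 + X ^+ 5.
  by have := r16 19%N; rewrite h19 h21 h27 !mulr0 !addr0 => ->; ring.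
have h39 : p 39%N = X ^+ 9.
  have := r16 23%N; rewrite h23 h25 h31 => ->.
  by rewrite -[RHS]addr0 -(c2 (X ^+ 33)); ring.
have h41 : p 41%N = X ^+ 23.
  by have := r16 25%N; rewrite h25 h27 h33 !mulr0 !addr0 => ->; ring.
have h47 : p 47%N = X ^+ 41 + X ^+ 17.
  by have := r16 31%N; rewrite h33 mulr0 addr0 h31 h39 => ->; ring.
by split.
Qed.

Lemma has_lead_small m : (m < 8)%N -> has_lead m.
Proof.
have [[h5 h11 h17 h23] [h29 h35 h41 h47]] := hecke_pow_mod6_small.
case: m => [|[|[|[|[|[|[|[|//]]]]]]]] _.
- apply: (@has_lead_of_eq _ 0); [exact: in_span0|exact: etrans h5 (esym (addr0 _))].
- apply: (@has_lead_of_eq _ 0); [exact: in_span0|exact: etrans h11 (esym (addr0 _))].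
- apply: (@has_lead_of_eq _ 0); [exact: in_span0|exact: etrans h17 (esym (addr0 _))].
- apply: (@has_lead_of_eq _ 0); [exact: in_span0|exact: etrans h23 (esym (addr0 _))].
- apply: (@has_lead_of_eq _ 0); [exact: in_span0|exact: etrans h29 (esym (addr0 _))].
- by apply: (@has_lead_of_eq _ (mon 0)); [exact: in_span_mon|exact: h35].
- apply: (@has_lead_of_eq _ 0); [exact: in_span0|exact: etrans h41 (esym (addr0 _))].
- by apply: (@has_lead_of_eq _ (mon 2)); [exact: in_span_mon|exact: h47].
Qed.

Lemma has_lead_all m : has_lead m.
Proof.
elim/ltn_ind: m => m IH; have [|m8] := ltnP m 8; first exact: has_lead_small.
(* The leading binary digit of [m] is [2^(k+3) = 8 q]; the parity of [k] selects the step lemma. *)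
have [k [km mk]] : exists k, (2 ^ k.+3 <= m)%N /\ (m < 2 ^ k.+4)%N.
  have h3 : (3 <= trunc_log 2 m)%N by rewrite trunc_log_max.
  exists (trunc_log 2 m - 3)%N; rewrite -addn3 subnK //.
  by rewrite trunc_logP ?trunc_log_ltn //; lia.
have E j : (4 ^ j = 2 ^ (2 * j))%N by rewrite expnM.
have p0 : (0 < 2 ^ k)%N by rewrite expn_gt0.
have em : m = (m - 2 ^ k.+3 + 2 ^ k.+3)%N by rewrite subnK.
have lt1 : (m - 2 ^ k.+3 < 2 ^ k.+3)%N by move: mk; rewrite !expnS; lia.
have IH' j : (j < 2 ^ k.+3)%N -> has_lead (m - 2 ^ k.+3 + j).
  by move=> jk; apply: IH; lia.
have q1 : (2 ^ k < 2 ^ k.+3)%N by rewrite !expnS; lia.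
have q2 : (2 * 2 ^ k < 2 ^ k.+3)%N by rewrite !expnS; lia.
have h0 := IH' 0%N ltac:(lia); rewrite addn0 in h0.
have h1 := IH' _ q1; have h2 := IH' _ q2.
rewrite em; move: (m - 2 ^ k.+3)%N lt1 h0 h1 h2 => m' lt1 h0 h1 h2.
have ek := odd_double_half k; case: (odd k) ek => /= ek.
  have e2 : (2 ^ k = 2 * 4 ^ k./2)%N by rewrite E -expnS -{1}ek; congr (2 ^ _)%N; lia.
  have e3 : (2 ^ k.+3 = 4 ^ (k./2).+2)%N by rewrite !expnS e2; lia.
  have e1 : (2 * 2 ^ k = 4 ^ (k./2).+1)%N by rewrite expnS e2; lia.
  rewrite e1 in h2; rewrite e2 in h1; rewrite e3 in lt1 *.
  exact: has_lead_step_odd lt1 h0 h1 h2.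
have e2 : (2 ^ k = 4 ^ k./2)%N by rewrite E -{1}ek; congr (2 ^ _)%N; lia.
have e3 : (2 ^ k.+3 = 2 * 4 ^ (k./2).+1)%N by rewrite !expnS e2; lia.
rewrite e2 in h1 h2; rewrite e3 in lt1 *.
exact: has_lead_step_even lt1 h0 h1 h2.
Qed.

(** * Return to the monomials [a,b,G] *)

Lemma monGE a b : monG a b = mon (code a b).
Proof. by rewrite /monG /mon /code; congr (_ ^+ _); lia. Qed.

Lemma sum_mon_monG (s : seq nat) :
  \sum_(u <- s) mon u = \sum_(u <- [seq (ebits m, obits m) | m <- s]) monG u.1 u.2.
Proof.
by rewrite big_map; apply: eq_bigr => u _; rewrite monGE /code bits_code.
Qed.

Theorem theorem2p24 (a b : nat) :
  (exists s : seq (nat * nat),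
     (forall c d : nat, (c, d) \in s -> (c + d < a + b)%N) /\
     hecke 7 (monG a b) = \sum_(u <- s) monG u.1 u.2) /\
  ((0 < a)%N ->
   exists s : seq (nat * nat),
     (forall c d : nat, (c, d) \in s -> earlier (c, d) ((a - 1)%N, b)) /\
     hecke 7 (monG a b) = monG (a - 1) b + \sum_(u <- s) monG u.1 u.2).
Proof.
have [s ls es] := has_lead_all (code a b).
have [ea eb] := bits_of_code a b.
have {es} es : hecke 7 (monG a b) = lead (code a b) + \sum_(u <- s) mon u.
  by rewrite monGE -es addrCA addss addr0.
have ls' c d : (c, d) \in [seq (ebits m, obits m) | m <- s] -> earlier (c.+1, d) (a, b).
  by case/mapP => u us [-> ->]; move/allP: ls => /(_ u us); rewrite /low ea eb.
rewrite es sum_mon_monG /lead ea eb -monGE; case: posnP => [a0|a0]; split=> //.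
- exists [seq (ebits m, obits m) | m <- s]; split; last by rewrite add0r.
  by move=> c d /ls'; rewrite /earlier /=; lia.
(* For the first claim the leading monomial joins the list, its index sum being [a + b - 1]. *)
- exists ((a - 1, b)%N :: [seq (ebits m, obits m) | m <- s]); split; last by rewrite big_cons.
  move=> c d; rewrite inE => /orP[/eqP[-> ->]|/ls']; rewrite /earlier /=; lia.
- move=> _; exists [seq (ebits m, obits m) | m <- s]; split=> // c d /ls'.
  by rewrite /earlier /=; lia.
Qed.
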